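(* Let $\pi:H\to\bar H$ be a Hopf algebra map, let $\bar A$ be a right $\bar H$-comodule algebra and let $B=\bar A^{\mathrm{co}\,\bar H}$ be its subalgebra of coinvariants. The prolongation $\bar A\square_{\bar H}H$ is a cleft extension of $B$ (with respect to the right $H$-coaction $\mathrm{id}\otimes\Delta_H$) if and only if there exists a right $\bar H$-colinear, unital, convolution invertible map $f:H\to\bar A$, where $H$ is a right $\bar H$-comodule by $(\mathrm{id}\otimes\pi)\circ\Delta_H$.
   Context: All algebras are associative, unital, over $\mathbb C$ (by convention they are also $*$-algebras, but this assumption may be dropped). Hopf algebras have bijective antipodes. Sweedler notation: $\Delta(h)=h_{(1)}\otimes h_{(2)}$ and $\rho(a)=a_{(0)}\otimes a_{(1)}$ for coactions. A right $H$-comodule algebra is an algebra which is a right $H$-comodule whose coaction is an algebra map; its coinvariants are $A^{\mathrm{co}\,H}=\{b\in A\mid \rho^H(b)=b\otimes 1\}$. Principal comodule algebra: a right $H$-comodule algebra $A$ with multiplication $\mu$ and unit map $\eta$ is principal if it admits a strong connection, i.e. a linear map $\ell:H\to A\otimes A$ with $\ell(1)=1\otimes 1$, $\mu\circ\ell=\eta\circ\varepsilon$, $(\ell\otimes\mathrm{id})\circ\Delta=(\mathrm{id}\otimes\rho^H)\circ\ell$ and $(S\otimes\ell)\circ\Delta=(\sigma\otimes\mathrm{id})\circ(\rho^H\otimes\mathrm{id})\circ\ell$, where $\sigma$ is the flip. Cleft: a principal right $H$-comodule algebra $A$ is a cleft extension of $A^{\mathrm{co}\,H}$ if there is a right $H$-colinear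 map $j:H\to A$ with $j(1)=1$ that is convolution invertible, i.e. there is a linear map $j^{-1}:H\to A$ with $j(h_{(1)})j^{-1}(h_{(2)})=j^{-1}(h_{(1)})j(h_{(2)})=\varepsilon(h)1$ for all $h\in H$. (Any comodule algebra with such a $j$ has the strong connection $\ell=(j^{-1}\otimes j)\circ\Delta$.) Convolution invertibility of $f:H\to\bar A$ is defined in the same way. Prolongation: $\bar A\square_{\bar H}H=\{\sum_i a^i\otimes h^i\in\bar A\otimes H\mid \sum_i a^i_{(0)}\otimes a^i_{(1)}\otimes h^i=\sum_i a^i\otimes\pi(h^i_{(1)})\otimes h^i_{(2)}\}$, a subalgebra of the tensor product algebra $\bar A\otimes H$ and a right $H$-comodule algebra via $\mathrm{id}\otimes\Delta_H$. Its $H$-coinvariants are identified with $B$ by $b\mapsto b\otimes 1$. *)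

(* Defs.v *)
From HB Require Import structures.
From mathcomp Require Import all_boot all_order all_algebra generic_quotient.
From mathcomp Require Import boolp classical_sets.

Set Implicit Arguments.
Unset Strict Implicit.
Unset Printing Implicit Defensive.

Import GRing.Theory.
Local Open Scope ring_scope.
Local Open Scope quotient_scope.

Reserved Notation "V \ox W" (at level 40, left associativity).
Reserved Notation "v *t w" (at level 40, left associativity).

Section Tensor.
Variables (K : fieldType) (V W : lmodType K).

(* V (x) W is presented as formal finite sums of pairs (v, w) modulo the least
   congruence making (v, w) bilinear; scalars are absorbed in the left factor,
   and v (x) 0 = 0 follows from tens_scale and tens_zero. *)
Inductive tens_rel : seq (V * W) -> seq (V * W) -> Prop :=
| tens_refl s : tens_rel s s
| tens_sym s t : tens_rel s t -> tens_rel t s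
| tens_trans s t u : tens_rel s t -> tens_rel t u -> tens_rel s u
| tens_cat s s' t t' :
    tens_rel s s' -> tens_rel t t' -> tens_rel (s ++ t) (s' ++ t')
| tens_comm s t : tens_rel (s ++ t) (t ++ s)
| tens_zero w : tens_rel [:: (0, w)] [::]
| tens_addl v v' w : tens_rel [:: (v + v', w)] [:: (v, w); (v', w)]
| tens_addr v w w' : tens_rel [:: (v, w + w')] [:: (v, w); (v, w')]
| tens_scale k v w : tens_rel [:: (k *: v, w)] [:: (v, k *: w)].

Definition tens_relb (s t : seq (V * W)) : bool := `[< tens_rel s t >].

Lemma tens_relb_refl : reflexive tens_relb.
Proof. by move=> s; apply/asboolP/tens_refl. Qed.

Lemma tens_relb_sym : symmetric tens_relb.
Proof. by move=> s t; apply/asboolP/asboolP => /tens_sym. Qed.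

Lemma tens_relb_trans : transitive tens_relb.
Proof.
by move=> t s u /asboolP st /asboolP tu; apply/asboolP/(tens_trans st).
Qed.

Canonical tens_equiv :=
  EquivRel tens_relb tens_relb_refl tens_relb_sym tens_relb_trans.

Definition tensor := {eq_quot tens_equiv}.

HB.instance Definition _ := Choice.on tensor.
HB.instance Definition _ := EqQuotient.on tensor.

Definition tpure (v : V) (w : W) : tensor := \pi_tensor [:: (v, w)].

Definition tzero : tensor := \pi_tensor [::].
Definition tadd (x y : tensor) : tensor := \pi_tensor (repr x ++ repr y).
Definition tscale (k : K) (x : tensor) : tensor :=
  \pi_tensor [seq (k *: p.1, p.2) | p <- repr x].
Definition topp (x : tensor) : tensor := tscale (-1) x.

Lemma piP s t : \pi_tensor s = \pi_tensor t <-> tens_rel s t.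
Proof.
split=> [/eqP|st]; first by rewrite eqmodE /= => /asboolP.
by apply/eqP; rewrite eqmodE /=; apply/asboolP.
Qed.

Lemma repr_rel s : tens_rel (repr (\pi_tensor s)) s.
Proof. by apply/piP; rewrite reprK. Qed.

Lemma tadd_pi s t : tadd (\pi_tensor s) (\pi_tensor t) = \pi_tensor (s ++ t).
Proof. by apply/piP/tens_cat; apply: repr_rel. Qed.

Lemma scale_rel k s t : tens_rel s t ->
  tens_rel [seq (k *: p.1, p.2) | p <- s] [seq (k *: p.1, p.2) | p <- t].
Proof.
elim=> /= {s t}.
- by move=> s; apply: tens_refl.
- by move=> s t _ /tens_sym.
- by move=> s t u _ st _ /(tens_trans st).
- by move=> s s' t t' _ ? _ ?; rewrite !map_cat; apply: tens_cat.
- by move=> s t; rewrite !map_cat; apply: tens_comm.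
- by move=> w; rewrite scaler0; apply: tens_zero.
- by move=> v v' w; rewrite scalerDr; apply: tens_addl.
- by move=> v w w'; apply: tens_addr.
- by move=> l v w; rewrite scalerA mulrC -scalerA; apply: tens_scale.
Qed.

Lemma tscale_pi k s :
  tscale k (\pi_tensor s) = \pi_tensor [seq (k *: p.1, p.2) | p <- s].
Proof. by apply/piP/scale_rel/repr_rel. Qed.

Lemma taddA : associative tadd.
Proof.
elim/quotW=> s; elim/quotW=> t; elim/quotW=> u.
by rewrite (tadd_pi t u) (tadd_pi s t) (tadd_pi s) tadd_pi catA.
Qed.

Lemma taddC : commutative tadd.
Proof. by move=> x y; apply/piP/tens_comm. Qed.

Lemma tadd0 : left_id tzero tadd.
Proof. by move=> x; rewrite -[x]reprK tadd_pi. Qed.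

Lemma tscaleDl x : {morph tscale^~ x : a b / a + b >-> tadd a b}.
Proof.
move=> a b; rewrite -[x]reprK !tscale_pi tadd_pi; apply/piP.
elim: (repr x) => [|[v w] s IHs] /=; first exact: tens_refl.
rewrite scalerDl.
have h := tens_cat (tens_addl (a *: v) (b *: v) w) IHs.
apply: tens_trans h _; rewrite -cat1s /=.
apply: (tens_cat (tens_refl [:: (a *: v, w)])).
set s1 := map _ _; set s2 := map _ _.
rewrite -[_ :: s1 ++ s2]/([:: (b *: v, w)] ++ s1 ++ s2) catA.
rewrite -[_ :: s2]/([:: (b *: v, w)] ++ s2) catA.
by apply: tens_cat (tens_refl _); apply: tens_comm.
Qed.

Lemma tscale0 x : tscale 0 x = tzero.
Proof.
rewrite -[x]reprK tscale_pi; apply/piP.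
elim: (repr x) => [|[v w] s IHs] /=; first exact: tens_refl.
by rewrite scale0r; apply: (tens_cat (tens_zero w) IHs).
Qed.

Lemma tscale1 : left_id 1 tscale.
Proof.
elim/quotW=> s; rewrite tscale_pi; congr (\pi_tensor _).
by rewrite -[RHS]map_id; apply: eq_map => -[v w] /=; rewrite scale1r.
Qed.

Lemma taddN : left_inverse tzero topp tadd.
Proof.
by move=> x; rewrite -{2}[x]tscale1 -tscaleDl addNr tscale0.
Qed.

HB.instance Definition _ := GRing.isZmodule.Build tensor taddA taddC tadd0 taddN.

Lemma tscaleA a b x : tscale a (tscale b x) = tscale (a * b) x.
Proof.
elim/quotW: x => s.
rewrite (tscale_pi b) !tscale_pi -map_comp; congr (\pi_tensor _).
by apply: eq_map => -[v w] /=; rewrite scalerA.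
Qed.

Lemma tscaleDr : right_distributive tscale +%R.
Proof.
move=> a; elim/quotW=> s; elim/quotW=> t.
by rewrite [_ + _]tadd_pi !tscale_pi map_cat -tadd_pi.
Qed.

HB.instance Definition _ :=
  GRing.Zmodule_isLmodule.Build K tensor tscaleA tscale1 tscaleDr tscaleDl.

End Tensor.

Notation "V \ox W" := (tensor V W).
Notation "v *t w" := (tpure v w).

Section TensorUniversal.
Variable K : fieldType.

Section PureTensors.
Variables (V W : lmodType K).
Implicit Types (v : V) (w : W).

Lemma tpureDl v v' w : (v + v') *t w = v *t w + v' *t w.
Proof. by rewrite [RHS]tadd_pi; apply/piP/tens_addl. Qed.

Lemma tpureDr v w w' : v *t (w + w') = v *t w + v *t w'.
Proof. by rewrite [RHS]tadd_pi; apply/piP/tens_addr. Qed.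

Lemma tpureZl k v w : (k *: v) *t w = k *: (v *t w).
Proof. by rewrite [RHS]tscale_pi. Qed.

Lemma tpureZr k v w : v *t (k *: w) = k *: (v *t w).
Proof. by rewrite -tpureZl; apply/esym/piP/tens_scale. Qed.

Lemma tensor_sum (x : V \ox W) : x = \sum_(p <- repr x) p.1 *t p.2.
Proof.
rewrite -[LHS]reprK; elim: (repr x) => [|[v w] s IHs]; first by rewrite big_nil.
by rewrite big_cons -IHs [RHS]tadd_pi.
Qed.

Lemma tensor_ind (P : V \ox W -> Prop) :
  P 0 -> (forall x y, P x -> P y -> P (x + y)) -> (forall v w, P (v *t w)) ->
  forall x, P x.
Proof.
by move=> P0 PD Pp x; rewrite [x]tensor_sum; apply: (big_ind P).
Qed.

Lemma tensor_ext (U : lmodType K) (f g : {linear V \ox W -> U}) :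
  (forall v w, f (v *t w) = g (v *t w)) -> f =1 g.
Proof.
move=> fg; elim/tensor_ind => [|x y fx fy|//]; first by rewrite !linear0.
by rewrite !linearD fx fy.
Qed.

End PureTensors.

Definition bilin (U V W : lmodType K) (B : U -> V -> W) : Prop :=
  (forall v, linear (B^~ v)) /\ (forall u, linear (B u)).

Section Lift.
Variables (U V W : lmodType K).

Lemma tpure_bilin : bilin (@tpure K V W).
Proof.
split=> [w k v v' | v k w w'] /=; first by rewrite tpureDl tpureZl.
by rewrite tpureDr tpureZr.
Qed.

Variables (B : V -> W -> U) (hB : bilin B).

Lemma bilinDl v v' w : B (v + v') w = B v w + B v' w.
Proof. by have := hB.1 w 1 v v'; rewrite /= !scale1r. Qed.
Lemma bilinDr v w w' : B v (w + w') = B v w + B v w'.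
Proof. by have := hB.2 v 1 w w'; rewrite !scale1r. Qed.
Lemma bilin0l w : B 0 w = 0.
Proof. by apply: (addIr (B 0 w)); rewrite -bilinDl !add0r. Qed.
Lemma bilin0r v : B v 0 = 0.
Proof. by apply: (addIr (B v 0)); rewrite -bilinDr !add0r. Qed.
Lemma bilinZl k v w : B (k *: v) w = k *: B v w.
Proof. by have := hB.1 w k v 0; rewrite /= !addr0 bilin0l addr0. Qed.
Lemma bilinZr k v w : B v (k *: w) = k *: B v w.
Proof. by have := hB.2 v k w 0; rewrite /= !addr0 bilin0r addr0. Qed.

Definition tlift of bilin B := fun x : V \ox W =>
  \sum_(p <- repr x) B p.1 p.2.

Lemma tlift_rel (s t : seq (V * W)) : tens_rel s t ->
  \sum_(p <- s) B p.1 p.2 = \sum_(p <- t) B p.1 p.2.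
Proof.
elim=> //= {s t}.
- by move=> s t u _ -> _ ->.
- by move=> s s' t t' _ es _ et; rewrite !big_cat /= es et.
- by move=> s t; rewrite !big_cat /= addrC.
- by move=> w; rewrite big_seq1 big_nil bilin0l.
- by move=> v v' w; rewrite !big_cons !big_nil !addr0 bilinDl.
- by move=> v w w'; rewrite !big_cons !big_nil !addr0 bilinDr.
- by move=> k v w; rewrite !big_seq1 /= bilinZl bilinZr.
Qed.

Lemma tlift_pi s : tlift hB (\pi_(V \ox W) s) = \sum_(p <- s) B p.1 p.2.
Proof. exact/tlift_rel/repr_rel. Qed.

Lemma tlift_linear : linear (tlift hB).
Proof.
move=> k; elim/quotW=> s; elim/quotW=> t.
rewrite [_ *: _]tscale_pi [_ + _]tadd_pi !tlift_pi big_cat big_map /=.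
by rewrite scaler_sumr; congr (_ + _); apply: eq_bigr => p _; rewrite bilinZl.
Qed.

HB.instance Definition _ :=
  GRing.isLinear.Build K (V \ox W) U *:%R (tlift hB) tlift_linear.

Lemma tliftE v w : tlift hB (v *t w) = B v w.
Proof. by rewrite tlift_pi big_seq1. Qed.

End Lift.

Section Maps.
Variables (V V' W W' : lmodType K).

Lemma tmap_bilin (f : {linear V -> V'}) (g : {linear W -> W'}) :
  bilin (fun v w => f v *t g w).
Proof.
split=> [w k v v' | v k w w'] /=; rewrite linearP.
  by rewrite tpureDl tpureZl.
by rewrite tpureDr tpureZr.
Qed.

Definition tmap (f : {linear V -> V'}) (g : {linear W -> W'}) :
  V \ox W -> V' \ox W' := tlift (tmap_bilin f g).
HB.instance Definition _ f g := GRing.Linear.on (tmap f g).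

Lemma tmapE f g v w : tmap f g (v *t w) = f v *t g w.
Proof. exact: tliftE. Qed.

Lemma tflip_bilin : bilin (fun (v : V) (w : W) => w *t v).
Proof.
split=> [w k v v' | v k w w'] /=; first by rewrite tpureDr tpureZr.
by rewrite tpureDl tpureZl.
Qed.

Definition tflip : V \ox W -> W \ox V := tlift tflip_bilin.
HB.instance Definition _ := GRing.Linear.on tflip.

Lemma tflipE v w : tflip (v *t w) = w *t v.
Proof. exact: tliftE. Qed.

Lemma tlunit_bilin : bilin (fun (k : K^o) (v : V) => (k : K) *: v).
Proof.
split=> [v k a b | a k v v'] /=; first by rewrite scalerDl scalerA.
by rewrite scalerDr !scalerA mulrC.
Qed.

Definition tlunit : K^o \ox V -> V := tlift tlunit_bilin.
HB.instance Definition _ := GRing.Linear.on tlunit.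

Lemma tlunitE (k : K) v : tlunit ((k : K^o) *t v) = k *: v.
Proof. exact: tliftE. Qed.

Lemma trunit_bilin : bilin (fun (v : V) (k : K^o) => (k : K) *: v).
Proof.
split=> [a k v v' | v k a b] /=; first by rewrite scalerDr !scalerA mulrC.
by rewrite scalerDl scalerA.
Qed.

Definition trunit : V \ox K^o -> V := tlift trunit_bilin.
HB.instance Definition _ := GRing.Linear.on trunit.

Lemma trunitE (k : K) v : trunit (v *t (k : K^o)) = k *: v.
Proof. exact: tliftE. Qed.

End Maps.

Section Assoc.
Variables (U V W : lmodType K).

Lemma tassoc_bilin1 (w : W) : bilin (fun (u : U) (v : V) => u *t (v *t w)).
Proof.
split=> [v k u u' | u k v v'] /=; first by rewrite tpureDl tpureZl.
by rewrite tpureDl tpureZl tpureDr tpureZr.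
Qed.

Lemma tassoc_bilin :
  bilin (fun (x : U \ox V) (w : W) => tlift (tassoc_bilin1 w) x).
Proof.
split=> [w k x y | x k w w'] /=; first by rewrite linearP.
elim/tensor_ind: x => [|x y IHx IHy|u v]; first by rewrite !linear0 ?addr0.
  by rewrite !linearD /= IHx IHy addrACA.
by rewrite !tliftE tpureDr tpureZr tpureDr tpureZr.
Qed.

Definition tassoc : (U \ox V) \ox W -> U \ox (V \ox W) := tlift tassoc_bilin.
HB.instance Definition _ := GRing.Linear.on tassoc.

Lemma tassocE u v w : tassoc ((u *t v) *t w) = u *t (v *t w).
Proof. by rewrite /tassoc !tliftE. Qed.

End Assoc.
End TensorUniversal.

Arguments tassoc {K U V W}.
Arguments tflip {K V W}.
Arguments tlunit {K V}.
Arguments trunit {K V}.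

Section GeneralizedInverse.
Local Open Scope classical_set_scope.
Variables (K : fieldType) (V W : lmodType K) (f : {linear V -> W}).

Let partial_ginv (G : set (W * V)) : Prop :=
  [/\ forall (k : K) p q, G p -> G q -> G (k *: p + q),
      forall p, G p -> p.1 = 0 -> p.2 = 0
    & forall p v, G p -> p.1 = f v -> f p.2 = f v].

Let maximal_partial_ginv :
  exists2 G, partial_ginv G & forall p, partial_ginv p -> G `<=` p -> p `<=` G.
Proof.
have [|G [PG maxG]] := @Zorn_bigcup (W * V)%type partial_ginv.
  move=> F FP totF; split=> [k p q [G FG Gp] [G' FG' Gq]|p [G FG Gp]|p v [G FG Gp]].
  - have [GG'|G'G] := totF _ _ FG FG'.
      by exists G' => //; have [+ _ _] := FP _ FG'; apply => //; apply: GG'.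
    by exists G => //; have [+ _ _] := FP _ FG; apply => //; apply: G'G.
  - by have [_ + _] := FP _ FG; apply.
  - by have [_ _ +] := FP _ FG; apply.
exists G => // G' PG' GG' p G'p; apply: contrapT => nGp.
by apply: (maxG G') => //; split=> // /(_ _ G'p).
Qed.

Lemma linear_ginv : exists g : {linear W -> V}, forall v, f (g (f v)) = f v.
Proof.
have [G [Glin Gfun Gf] maxG] := maximal_partial_ginv.
have G0 : G 0.
  apply: (maxG (G `|` [set 0])); [|by move=> p; left|by right].
  split=> [k p q [Gp|->] [Gq|->]|p [Gp|->]|p v [Gp|->]] //; last 1 first.
  - by move=> /= <-; rewrite linear0.
  - by left; apply: Glin.
  - rewrite addr0; have [->|k0] := eqVneq k 0; first by right; rewrite scale0r.
    left; have -> : k *: p = (k - 1) *: p + p.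
      by rewrite scalerBl scale1r subrK.
    exact: Glin.
  - by left; rewrite scaler0 add0r.
  - by right; rewrite scaler0 add0r.
  - exact: Gfun.
  - exact: Gf.
have GZ k p : G p -> G (k *: p) by move=> Gp; rewrite -[_ *: _]addr0; apply: Glin.
have Gtotal w : exists v, G (w, v).
  have [//|nGw] := pselect (exists v, G (w, v)); exfalso.
  pose ext u : set (W * V) := [set p | exists a k, G a /\ p = a + k *: (w, u)].
  suff [u Pu] : exists u, partial_ginv (ext u).
    apply: nGw; exists u; apply: (maxG (ext u) Pu).
      by move=> p Gp; exists p, 0; rewrite scale0r addr0.
    by exists 0, 1; rewrite scale1r add0r.
  have extlin u k p q : ext u p -> ext u q -> ext u (k *: p + q).
    move=> [a [l [Ga ->]]] [b [m [Gb ->]]]; exists (k *: a + b), (k * l + m).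
    by split; [exact: Glin | rewrite scalerDr addrACA scalerA -scalerDl].
  have extfun u p : ext u p -> p.1 = 0 -> p.2 = 0.
    move=> [a [k [Ga ->]]] /= awk.
    have k0 : k = 0.
      apply/eqP/negP => /negP k0; apply: nGw; exists (- k^-1 *: a.2).
      have -> : w = - k^-1 *: a.1.
        rewrite (_ : a.1 = - (k *: w)); last by apply/eqP; rewrite -addr_eq0 awk.
        by rewrite scaleNr scalerN opprK scalerA mulVf // scale1r.
      exact: (GZ (- k^-1) a Ga).
    by move: awk; rewrite k0 !scale0r !addr0; apply: Gfun.
  have [[v0 [b [Gb wE]]]|nw] := pselect (exists v b, G b /\ w = f v + b.1).
    exists (v0 + b.2); split; [exact: extlin|exact: extfun|].
    move=> p v [a [k [Ga ->]]] /= eqv.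
    have /= h := Gf (k *: b + a) (v - k *: v0) (Glin _ _ _ Gb Ga).
    have -> : a.2 + k *: (v0 + b.2) = (k *: b.2 + a.2) + k *: v0.
      by rewrite scalerDr [k *: v0 + k *: b.2]addrC addrA [a.2 + k *: b.2]addrC.
    rewrite linearD h -?linearD ?subrK //= linearB linearZ /= -eqv wE scalerDr.
    by rewrite [k *: _ + k *: _]addrC addrA addrK addrC.
  exists 0; split; [exact: extlin|exact: extfun|].
  move=> p v [a [k [Ga ->]]] /= eqv.
  have k0 : k = 0.
    apply/eqP/negP => /negP k0; apply: nw; exists (k^-1 *: v), (- k^-1 *: a).
    split; first exact: GZ.
    rewrite linearZ /= -eqv scalerDr scalerA mulVf // scale1r scaleNr addrC.
    by rewrite addKr.
  by move: eqv; rewrite k0 !scale0r !addr0; apply: Gf.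
pose g w := sval (cid (Gtotal w)).
have gP w : G (w, g w) by exact: (svalP (cid (Gtotal w))).
have glin : linear g.
  move=> k x y; apply/eqP; rewrite -subr_eq0; apply/eqP.
  have h := Glin (-1) _ _ (Glin k _ _ (gP x) (gP y)) (gP (k *: x + y)).
  have := Gfun _ h; rewrite /= !scaleN1r addNr => /(_ erefl) {}h.
  by rewrite -h; apply: addrC.
pose gL := GRing.isLinear.Build K W V *:%R g glin.
pose gP' : {linear W -> V} := HB.pack g gL.
by exists gP' => v; apply: (Gf (f v, g (f v)) v (gP _)).
Qed.

End GeneralizedInverse.

Section Flatness.
Variables (K : fieldType) (S V E U : lmodType K).

Lemma tmap_comp (V1 V2 V3 W1 W2 W3 : lmodType K) (f' : {linear V2 -> V3})
    (f : {linear V1 -> V2}) (g' : {linear W2 -> W3}) (g : {linear W1 -> W2}) x :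
  tmap f' g' (tmap f g x) = tmap (f' \o f) (g' \o g) x.
Proof.
elim/tensor_ind: x => [|x y IHx IHy|v w]; first by rewrite !linear0.
  by rewrite !linearD /= IHx IHy.
by rewrite !tmapE.
Qed.

Lemma eq_tmap (V1 V2 W1 W2 : lmodType K) (f f' : {linear V1 -> V2})
    (g g' : {linear W1 -> W2}) : f =1 f' -> g =1 g' -> tmap f g =1 tmap f' g'.
Proof. by move=> ff gg; apply: tensor_ext => v w /=; rewrite !tmapE ff gg. Qed.

Lemma tmap_id (V1 W1 : lmodType K) (x : V1 \ox W1) : tmap idfun idfun x = x.
Proof.
by apply: (@tensor_ext _ _ _ _ (tmap idfun idfun) idfun) => v w /=; rewrite tmapE.
Qed.

Lemma tmap_inj (i : {linear S -> V}) :
  injective i -> injective (tmap i (idfun : U -> U)).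
Proof.
move=> inj_i; have [g gP] := linear_ginv i.
have gi s : g (i s) = s by apply: inj_i.
apply: (@can_inj _ _ _ (tmap g idfun)) => x; rewrite tmap_comp -[RHS]tmap_id.
exact: eq_tmap.
Qed.

Lemma tmap_exact (i : {linear S -> V}) (f : {linear V -> E}) :
  injective i -> (forall v, f v = 0 -> exists s, i s = v) ->
  forall x : V \ox U, tmap f idfun x = 0 -> exists y, tmap i idfun y = x.
Proof.
move=> inj_i exact_if x fx0; have [g gP] := linear_ginv f.
have rP v : exists s, i s = v - g (f v) by apply: exact_if; rewrite linearB gP subrr.
pose r v := sval (cid (rP v)).
have ir v : i (r v) = v - g (f v) by exact: (svalP (cid (rP v))).
have rlin : linear r.
  move=> k u v; apply: inj_i; rewrite linearP !ir.
  have -> : g (f (k *: u + v)) = k *: g (f u) + g (f v) by rewrite !linearP.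
  by rewrite opprD addrACA scalerBr.
pose rL := GRing.isLinear.Build K V S *:%R r rlin.
pose r' : {linear V -> S} := HB.pack r rL.
exists (tmap r' idfun x).
rewrite -[RHS]subr0 -(linear0 (tmap g idfun)) -fx0.
elim/tensor_ind: (x) => [|y z IHy IHz|v u]; first by rewrite !linear0 ?addr0.
  by rewrite !linearD /= IHy IHz addrACA.
by rewrite !tmapE /= ir tpureDl -scaleN1r tpureZl scaleN1r tmapE.
Qed.

End Flatness.

Section AssocInverse.
Variables (K : fieldType) (U V W : lmodType K).

Lemma tassocV_bilin1 (u : U) : bilin (fun (v : V) (w : W) => (u *t v) *t w).
Proof.
split=> [w k v v' | v k w w'] /=; last by rewrite tpureDr tpureZr.
by rewrite tpureDr tpureDl tpureZr tpureZl.
Qed.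

Lemma tassocV_bilin :
  bilin (fun (u : U) (x : V \ox W) => tlift (tassocV_bilin1 u) x).
Proof.
split=> [x k u u' | u k x y]; last by rewrite linearP.
elim/tensor_ind: x => [|x y IHx IHy|v w]; first by rewrite !linear0 ?addr0.
  by rewrite !linearD /= IHx IHy addrACA.
by rewrite !tliftE tpureDl tpureZl tpureDl tpureZl.
Qed.

Definition tassocV : U \ox (V \ox W) -> (U \ox V) \ox W := tlift tassocV_bilin.
HB.instance Definition _ := GRing.Linear.on tassocV.

Lemma tassocVE u v w : tassocV (u *t (v *t w)) = (u *t v) *t w.
Proof. by rewrite /tassocV !tliftE. Qed.

End AssocInverse.
Arguments tassocV {K U V W}.

Section PureZero.
Variables (K : fieldType) (U V : lmodType K).

Lemma tpure0l (v : V) : 0 *t v = 0 :> U \ox V.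
Proof. exact: (bilin0l (@tpure_bilin K U V)). Qed.

Lemma tpure0r (u : U) : u *t 0 = 0 :> U \ox V.
Proof. exact: (bilin0r (@tpure_bilin K U V)). Qed.

End PureZero.

Section AssocInverseTheory.
Variables (K : fieldType) (U V W : lmodType K).

Lemma tensor_ext3 (E : lmodType K) (f g : {linear (U \ox V) \ox W -> E}) :
  (forall u v w, f (u *t v *t w) = g (u *t v *t w)) -> f =1 g.
Proof.
move=> fg; apply: tensor_ext => x w /=; elim/tensor_ind: x => [|x y fx fy|//].
  by rewrite tpure0l !linear0.
by rewrite tpureDl !linearD fx fy.
Qed.

Lemma tensor_ext3r (E : lmodType K) (f g : {linear U \ox (V \ox W) -> E}) :
  (forall u v w, f (u *t (v *t w)) = g (u *t (v *t w))) -> f =1 g.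
Proof.
move=> fg; apply: tensor_ext => u x /=; elim/tensor_ind: x => [|x y fx fy|//].
  by rewrite tpure0r !linear0.
by rewrite tpureDr !linearD fx fy.
Qed.

Lemma tassocK : cancel (@tassoc K U V W) (@tassocV K U V W).
Proof.
apply: (@tensor_ext3 _ (@tassocV K U V W \o @tassoc K U V W) idfun) => u v w /=.
by rewrite tassocE tassocVE.
Qed.

Lemma tassocVK : cancel (@tassocV K U V W) (@tassoc K U V W).
Proof.
apply: (@tensor_ext3r _ (@tassoc K U V W \o @tassocV K U V W) idfun) => u v w /=.
by rewrite tassocVE tassocE.
Qed.

End AssocInverseTheory.

Section TensorAlgebra.
Variable K : fieldType.

Section Mul.
Variable A : algType K.

Lemma mul_bilin : bilin (@GRing.mul A).
Proof.
split=> [y k x x' | x k y y'] /=; first by rewrite mulrDl scalerAl.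
by rewrite mulrDr scalerAr.
Qed.

Definition tmul : A \ox A -> A := tlift mul_bilin.
HB.instance Definition _ := GRing.Linear.on tmul.

Lemma tmulE (x y : A) : tmul (x *t y) = x * y.
Proof. exact: tliftE. Qed.

Definition lmul (a : A) := fun x : A => a * x.

Lemma lmul_linear a : linear (lmul a).
Proof. by move=> k x y; rewrite /lmul mulrDr scalerAr. Qed.

HB.instance Definition _ a :=
  GRing.isLinear.Build K A A *:%R (lmul a) (lmul_linear a).

End Mul.

Variables (A B : algType K).

Lemma tensor_mul_bilin (y : A \ox B) :
  bilin (fun (a : A) (b : B) => tmap (lmul a) (lmul b) y).
Proof.
split=> [b k a a' | a k b b'];
  elim/tensor_ind: y => [|y z IHy IHz|c d]; rewrite ?linear0 ?addr0 //.
- by rewrite !linearD /= IHy IHz addrACA.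
- by rewrite !tmapE /= /lmul mulrDl -scalerAl tpureDl tpureZl.
- by rewrite !linearD /= IHy IHz addrACA.
- by rewrite !tmapE /= /lmul mulrDl -scalerAl tpureDr tpureZr.
Qed.

(* (a (x) b) (a' (x) b') = a a' (x) b b' *)
Definition tensor_mul (x y : A \ox B) : A \ox B := tlift (tensor_mul_bilin y) x.

Lemma tensor_mulE a b a' b' :
  tensor_mul (a *t b) (a' *t b') = (a * a') *t (b * b').
Proof. by rewrite /tensor_mul tliftE tmapE. Qed.

Lemma tensor_mulDl : left_distributive tensor_mul +%R.
Proof. by move=> x y z; rewrite /tensor_mul linearD. Qed.

Lemma tensor_mulDr : right_distributive tensor_mul +%R.
Proof.
move=> x y z; elim/tensor_ind: x => [|x x' IHx IHx'|a b].
- by rewrite /tensor_mul !linear0 ?addr0.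
- by rewrite !tensor_mulDl IHx IHx' addrACA.
- by rewrite /tensor_mul !tliftE linearD.
Qed.

Lemma tensor_mul0l x : tensor_mul 0 x = 0.
Proof. by rewrite /tensor_mul linear0. Qed.

Lemma tensor_mul0r x : tensor_mul x 0 = 0.
Proof. by apply: (addIr (tensor_mul x 0)); rewrite -tensor_mulDr !add0r. Qed.

Lemma tensor_mulA : associative tensor_mul.
Proof.
move=> x y z; elim/tensor_ind: x => [|x x' IHx IHx'|a b].
- by rewrite !tensor_mul0l.
- by rewrite !tensor_mulDl IHx IHx'.
elim/tensor_ind: y => [|y y' IHy IHy'|c d].
- by rewrite tensor_mul0l !tensor_mul0r tensor_mul0l.
- by rewrite tensor_mulDl !tensor_mulDr tensor_mulDl IHy IHy'.
elim/tensor_ind: z => [|z z' IHz IHz'|e f].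
- by rewrite !tensor_mul0r.
- by rewrite !tensor_mulDr IHz IHz'.
- by rewrite !tensor_mulE !mulrA.
Qed.

Lemma tensor_mul1l : left_id (1 *t 1) tensor_mul.
Proof.
elim/tensor_ind => [|x y IHx IHy|a b]; first by rewrite tensor_mul0r.
  by rewrite tensor_mulDr IHx IHy.
by rewrite tensor_mulE !mul1r.
Qed.

Lemma tensor_mul1r : right_id (1 *t 1) tensor_mul.
Proof.
elim/tensor_ind => [|x y IHx IHy|a b]; first by rewrite tensor_mul0l.
  by rewrite tensor_mulDl IHx IHy.
by rewrite tensor_mulE !mulr1.
Qed.

Lemma unit_functional (C : algType K) : exists e : {linear C -> K^o}, e 1 = 1.
Proof.
pose i (k : K^o) : C := (k : K) *: 1.
have ilin : linear i by move=> k a b; rewrite /i scalerDl scalerA.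
pose iL := GRing.isLinear.Build K K^o C *:%R i ilin.
pose i' : {linear K^o -> C} := HB.pack i iL.
have [e eP] := linear_ginv i'.
have /= e1 := eP 1; rewrite /i scale1r in e1.
have : ((e 1 : K) - 1) *: (1 : C) == 0 by rewrite scalerBl e1 scale1r subrr.
by rewrite scaler_eq0 oner_eq0 orbF subr_eq0 => /eqP; exists e.
Qed.

Lemma tensor_oner_neq0 : 1 *t 1 != 0 :> A \ox B.
Proof.
have [[e e1] [e' e'1]] := (unit_functional A, unit_functional B).
apply/eqP => /(congr1 (tlunit \o tmap e e'))/eqP.
by rewrite /= tmapE e1 e'1 tlunitE scale1r !linear0 oner_eq0.
Qed.

HB.instance Definition _ := GRing.Zmodule_isNzRing.Build (A \ox B)
  tensor_mulA tensor_mul1l tensor_mul1r tensor_mulDl tensor_mulDr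
  tensor_oner_neq0.

Lemma tensor_scalerAl k (x y : A \ox B) : k *: (x * y) = (k *: x) * y.
Proof. by rewrite ![_ * _]/(tensor_mul _ _) /tensor_mul linearZ. Qed.

Lemma tensor_scalerAr k (x y : A \ox B) : k *: (x * y) = x * (k *: y).
Proof.
elim/tensor_ind: x => [|x x' IHx IHx'|a b]; first by rewrite !mul0r scaler0.
  by rewrite !mulrDl scalerDr IHx IHx'.
by rewrite ![_ * _]/(tensor_mul _ _) /tensor_mul !tliftE linearZ.
Qed.

HB.instance Definition _ :=
  GRing.Lmodule_isLalgebra.Build K (A \ox B) tensor_scalerAl.
HB.instance Definition _ :=
  GRing.Lalgebra_isAlgebra.Build K (A \ox B) tensor_scalerAr.

Lemma tpureM (a a' : A) (b b' : B) :
  (a *t b) * (a' *t b') = (a * a') *t (b * b').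
Proof. exact: tensor_mulE. Qed.

Lemma tpure1 : 1 *t 1 = 1 :> A \ox B.
Proof. by []. Qed.

Lemma tensor_morphM (C : algType K) (f : {linear A \ox B -> C}) :
  (forall a b a' b',
     f ((a *t b) * (a' *t b')) = f (a *t b) * f (a' *t b')) ->
  {morph f : x y / x * y}.
Proof.
move=> fM x y; elim/tensor_ind: x => [|x x' IHx IHx'|a b].
- by rewrite mul0r linear0 mul0r.
- by rewrite mulrDl !linearD mulrDl IHx IHx'.
elim/tensor_ind: y => [|y y' IHy IHy'|//]; first by rewrite mulr0 linear0 mulr0.
by rewrite mulrDr !linearD mulrDr IHy IHy'.
Qed.

End TensorAlgebra.

Arguments tmul {K A}.

Section TensorAlgebraMorphisms.
Variable K : fieldType.
Implicit Types A B C : algType K.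

Lemma comp_alg A B C (f : {linear B -> C}) (g : {linear A -> B}) :
  monoid_morphism f -> monoid_morphism g -> monoid_morphism (f \o g).
Proof.
move=> [f1 fM] [g1 gM]; split; first by rewrite /= g1 f1.
by move=> x y; rewrite /= gM fM.
Qed.

Lemma idfun_alg A : monoid_morphism (idfun : A -> A).
Proof. by []. Qed.

Lemma tmap_alg A B (A' B' : algType K) (f : {linear A -> A'})
    (g : {linear B -> B'}) :
  monoid_morphism f -> monoid_morphism g -> monoid_morphism (tmap f g).
Proof.
move=> [f1 fM] [g1 gM]; split; first by rewrite -tpure1 /= tmapE f1 g1.
by apply: tensor_morphM => a b a' b'; rewrite tpureM /= !tmapE tpureM fM gM.
Qed.

Lemma tassoc_alg A B C : monoid_morphism (@tassoc K A B C).
Proof.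
split; first by rewrite -!tpure1 tassocE.
apply: tensor_morphM => x c y d; rewrite tpureM.
elim/tensor_ind: x => [|x x' IHx IHx'|a b].
- by rewrite mul0r !tpure0l linear0 mul0r.
- by rewrite mulrDl !tpureDl !linearD mulrDl IHx IHx'.
elim/tensor_ind: y => [|y y' IHy IHy'|a' b'].
- by rewrite mulr0 !tpure0l linear0 mulr0.
- by rewrite mulrDr !tpureDl !linearD mulrDr IHy IHy'.
by rewrite tpureM /= !tassocE !tpureM.
Qed.

Lemma can_alg A B (f : {linear A -> B}) (g : {linear B -> A}) :
  cancel f g -> cancel g f -> monoid_morphism f -> monoid_morphism g.
Proof.
move=> fK gK [f1 fM]; split; first by rewrite -f1 fK.
by move=> x y; apply: (can_inj fK); rewrite fM !gK.
Qed.

Lemma tassocV_alg A B C : monoid_morphism (@tassocV K A B C).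
Proof. exact: can_alg (@tassocK _ _ _ _) (@tassocVK _ _ _ _) (tassoc_alg _ _ _). Qed.

End TensorAlgebraMorphisms.

(* Algebras are algTypes, hence nonzero. *)
Record hopfAlg (K : fieldType) := HopfAlg {
  hopf_alg :> algType K;
  comul : {lrmorphism hopf_alg -> hopf_alg \ox hopf_alg};
  counit : {lrmorphism hopf_alg -> K^o};
  antipode : {linear hopf_alg -> hopf_alg};
  comulA : forall h,
    tassoc (tmap comul idfun (comul h)) = tmap idfun comul (comul h);
  counitl : forall h, tlunit (tmap counit idfun (comul h)) = h;
  counitr : forall h, trunit (tmap idfun counit (comul h)) = h;
  antipodel : forall h, tmul (tmap antipode idfun (comul h)) = (counit h)%:A;
  antipoder : forall h, tmul (tmap idfun antipode (comul h)) = (counit h)%:A;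
  antipode_bij : bijective antipode
}.

Record hopfHom (K : fieldType) (H H' : hopfAlg K) := HopfHom {
  hopf_hom :> {lrmorphism H -> H'};
  hopf_hom_comul : forall h,
    comul H' (hopf_hom h) = tmap hopf_hom hopf_hom (comul H h);
  hopf_hom_counit : forall h, counit H' (hopf_hom h) = counit H h;
  hopf_hom_antipode : forall h, hopf_hom (antipode H h) = antipode H' (hopf_hom h)
}.

Record comodAlg (K : fieldType) (H : hopfAlg K) := ComodAlg {
  comod_alg :> algType K;
  coact : {lrmorphism comod_alg -> comod_alg \ox H};
  coactA : forall a,
    tassoc (tmap coact idfun (coact a)) = tmap idfun (comul H) (coact a);
  coact_counit : forall a, trunit (tmap idfun (counit H) (coact a)) = a
}.

Section Coinvariants.
Variables (K : fieldType) (H : hopfAlg K) (A : comodAlg H).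

Definition coinv_pred : {pred A} := fun b => coact A b == b *t 1.

Record coinv := Coinv { coinv_val :> A; _ : coinv_val \in coinv_pred }.

HB.instance Definition _ := [isSub for coinv_val].
HB.instance Definition _ := [Choice of coinv by <:].

Lemma coinv_closed : subalg_closed coinv_pred.
Proof.
split=> [|k x y|x y]; rewrite !unfold_in ?rmorph1 //=.
  move=> /eqP xE /eqP yE.
  by rewrite linearP /= xE yE tpureDl tpureZl.
move=> /eqP xE /eqP yE.
by rewrite rmorphM /= xE yE tpureM mulr1.
Qed.

HB.instance Definition _ := GRing.SubChoice_isSubAlgebra.Build K A coinv_pred coinv
  (GRing.subalg_closed_semi coinv_closed).

Lemma coinvP (b : coinv) : coact A (val b) = val b *t 1.
Proof. exact/eqP/(valP b). Qed.

End Coinvariants.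

Section Reassociation.
Variables (K : fieldType) (U V W X : lmodType K).

Local Ltac tind x :=
  elim/tensor_ind: x;
  [ by rewrite !(tpure0l, tpure0r, linear0)
  | let IH1 := fresh "IH" in let IH2 := fresh "IH" in
    move=> ? ? IH1 IH2;
    by rewrite !(tpureDl, tpureDr, linearD) /= IH1 IH2
  | move=> ? ? ].

Lemma tassoc_tassocV (u : U) (s : V \ox W) (x : X) :
  tassoc (tassocV (u *t s) *t x) = tassocV (u *t tassoc (s *t x)).
Proof. by tind s; rewrite tassocVE !tassocE tassocVE. Qed.

Lemma tassocV_tassocV (u : U) (v : V) (t : W \ox X) :
  tassocV (u *t tassocV (v *t t)) = tmap tassoc idfun (tassocV ((u *t v) *t t)).
Proof. by tind t; rewrite !tassocVE tmapE /= tassocE. Qed.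

Lemma tassocV_tmap (g : {linear W -> X}) (u : U) (t : V \ox W) :
  tmap idfun g (tassocV (u *t t)) = tassocV (u *t tmap idfun g t).
Proof. by tind t; rewrite tassocVE !tmapE tassocVE. Qed.

Lemma tmap_tassoc (f : {linear U -> X}) (s : U \ox V) (w : W) :
  tmap f idfun (tassoc (s *t w)) = tassoc (tmap f idfun s *t w).
Proof. by tind s; rewrite tassocE !tmapE tassocE. Qed.

Lemma tassocV_tmapl (f : {linear U -> X}) (y : (U \ox V) \ox W) :
  tassocV (tmap f idfun (tassoc y)) = tmap (tmap f idfun) idfun y.
Proof.
tind y; rewrite tmapE /=; set s := (X in X *t _); set w := (X in _ *t X).
by rewrite tmap_tassoc tassocK.
Qed.

Lemma trunit_tassocV (e : {linear W -> K^o}) (u : U) (t : V \ox W) :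
  trunit (tmap idfun e (tassocV (u *t t))) = u *t trunit (tmap idfun e t).
Proof. by tind t; rewrite tassocVE !tmapE /= !trunitE tpureZr. Qed.

Lemma linear_trunit (f : {linear U -> V}) (e : {linear W -> K^o}) (x : U \ox W) :
  f (trunit (tmap idfun e x)) = trunit (tmap idfun e (tmap f idfun x)).
Proof. by tind x; rewrite !tmapE /= !trunitE linearZ. Qed.

Lemma tmapBl (f g : {linear U -> V}) (x : U \ox W) :
  tmap (f \- g) idfun x = tmap f idfun x - tmap g idfun x.
Proof.
elim/tensor_ind: x => [|x y IHx IHy|u w]; first by rewrite !linear0 addr0.
  by rewrite !linearD /= IHx IHy addrACA.
by rewrite !tmapE /= tpureDl -scaleN1r tpureZl scaleN1r.
Qed.

End Reassociation.

Section Prolongation.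
Variables (K : fieldType) (H Hbar : hopfAlg K) (pi : hopfHom H Hbar).
Variable A : comodAlg Hbar.

(* The two maps  sum a_i (x) h_i |-> sum a_i(0) (x) a_i(1) (x) h_i  and
   sum a_i (x) h_i |-> sum a_i (x) pi(h_i(1)) (x) h_i(2)  whose equalizer is
   the cotensor product of A and H over Hbar. *)
Definition cotensl : A \ox H -> A \ox (Hbar \ox H) :=
  tassoc \o tmap (coact A) idfun.
Definition cotensr : A \ox H -> A \ox (Hbar \ox H) :=
  tmap idfun (tmap pi idfun \o comul H).
HB.instance Definition _ := GRing.Linear.on cotensl.
HB.instance Definition _ := GRing.Linear.on cotensr.

Definition prolong_pred : {pred A \ox H} := fun x => cotensl x == cotensr x.

Record prolong_alg :=
  ProlongAlg { prolong_val :> A \ox H; _ : prolong_val \in prolong_pred }.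

HB.instance Definition _ := [isSub for prolong_val].
HB.instance Definition _ := [Choice of prolong_alg by <:].

Lemma lrmorphism_alg (B C : algType K) (f : {lrmorphism B -> C}) :
  monoid_morphism f.
Proof. exact: rmorphism_monoidP. Qed.

Lemma cotensl_alg : monoid_morphism cotensl.
Proof.
apply: comp_alg; first exact: tassoc_alg.
by apply: tmap_alg; [exact: lrmorphism_alg | exact: idfun_alg].
Qed.

Lemma cotensr_alg : monoid_morphism cotensr.
Proof.
apply: tmap_alg; first exact: idfun_alg.
apply: comp_alg; last exact: lrmorphism_alg.
by apply: tmap_alg; [exact: lrmorphism_alg | exact: idfun_alg].
Qed.

Lemma prolong_closed : subalg_closed prolong_pred.
Proof.
have [[l1 lM] [r1 rM]] := (cotensl_alg, cotensr_alg).
split=> [|k x y|x y]; rewrite !unfold_in.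
- by rewrite l1 r1.
- by move=> /eqP xE /eqP yE; rewrite !linearP /= xE yE.
- by move=> /eqP xE /eqP yE; rewrite lM rM xE yE.
Qed.

HB.instance Definition _ :=
  GRing.SubChoice_isSubAlgebra.Build K (A \ox H) prolong_pred prolong_alg
  (GRing.subalg_closed_semi prolong_closed).

Definition pval : prolong_alg -> A \ox H := val.
HB.instance Definition _ := GRing.Linear.on pval.

Lemma pval_alg : monoid_morphism pval.
Proof. by split=> [|x y]; rewrite /pval ?rmorph1 ?rmorphM. Qed.

Lemma pval_inj : injective pval.
Proof. exact: val_inj. Qed.

(* id (x) Delta_H, with values reassociated. *)
Definition id_comul : A \ox H -> (A \ox H) \ox H :=
  tassocV \o tmap idfun (comul H).
HB.instance Definition _ := GRing.Linear.on id_comul.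

Lemma id_comul_alg : monoid_morphism id_comul.
Proof.
apply: comp_alg; first exact: tassocV_alg.
by apply: tmap_alg; [exact: idfun_alg | exact: lrmorphism_alg].
Qed.

Lemma id_comulE a h : id_comul (a *t h) = tassocV (a *t comul H h).
Proof. by rewrite /id_comul /= tmapE. Qed.

Lemma id_comulA x :
  tassoc (tmap id_comul idfun (id_comul x)) = tmap idfun (comul H) (id_comul x).
Proof.
elim/tensor_ind: x => [|x y IHx IHy|a h]; first by rewrite !linear0.
  by rewrite !linearD /= IHx IHy.
rewrite id_comulE tassocV_tmap -comulA.
elim/tensor_ind: (comul H h) => [|s t IHs IHt|u v].
- by rewrite !(tpure0r, linear0).
- by rewrite !(tpureDr, linearD) /= IHs IHt.
- by rewrite tassocVE !tmapE /= id_comulE tassoc_tassocV.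
Qed.

Lemma id_comul_counit x : trunit (tmap idfun (counit H) (id_comul x)) = x.
Proof.
elim/tensor_ind: x => [|x y IHx IHy|a h]; first by rewrite !linear0.
  by rewrite !linearD /= IHx IHy.
by rewrite id_comulE trunit_tassocV counitr.
Qed.

Lemma cotensl_id_comul x :
  tmap cotensl idfun (id_comul x) =
  tassocV (tmap idfun (tassocV \o tmap idfun (comul H)) (cotensl x)).
Proof.
elim/tensor_ind: x => [|x y IHx IHy|a h]; first by rewrite !linear0.
  by rewrite !linearD /= IHx IHy.
rewrite id_comulE /cotensl /= tmapE /=.
transitivity (tmap (tassoc : _ -> A \ox (Hbar \ox H)) idfun
                (tassocV (coact A a *t comul H h))).
  elim/tensor_ind: (comul H h) => [|s t IHs IHt|u v].
  - by rewrite !(tpure0r, linear0).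
  - by rewrite !(tpureDr, linearD) /= IHs IHt.
  - by rewrite !tassocVE !tmapE /= /cotensl /= tmapE.
elim/tensor_ind: (coact A a) => [|s t IHs IHt|u v].
- by rewrite !(tpure0l, linear0).
- by rewrite !(tpureDl, linearD) /= IHs IHt.
- by rewrite tassocE tmapE /= tmapE tassocV_tassocV.
Qed.

Lemma cotensr_id_comul x :
  tmap cotensr idfun (id_comul x) =
  tassocV (tmap idfun (tassocV \o tmap idfun (comul H)) (cotensr x)).
Proof.
elim/tensor_ind: x => [|x y IHx IHy|a h]; first by rewrite !linear0.
  by rewrite !linearD /= IHx IHy.
rewrite id_comulE /cotensr !tmapE /=.
transitivity (tassocV (a *t
    tmap (tmap pi (idfun : H -> H)) (idfun : H -> H)
      (tmap (comul H) idfun (comul H h)))).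
  elim/tensor_ind: (comul H h) => [|s t IHs IHt|u v].
  - by rewrite !(tpure0r, linear0).
  - by rewrite !(tpureDr, linearD) /= IHs IHt.
  - by rewrite !tassocVE !tmapE /= /cotensr tmapE /= tassocVE.
congr tassocV; congr tpure; rewrite -tassocV_tmapl comulA !tmap_comp.
by congr tassocV; apply: eq_tmap.
Qed.

(* Over a field, (A []_Hbar H) (x) H embeds in (A (x) H) (x) H (tmap_inj), and
   id (x) Delta_H maps the cotensor product into it; prolong_coactE below
   characterizes the resulting coaction on the prolongation. *)
Lemma prolong_coact_subproof (x : prolong_alg) :
  exists y : prolong_alg \ox H, tmap pval idfun y = id_comul (val x).
Proof.
apply: (@tmap_exact _ _ _ _ _ pval (cotensl \- cotensr)); first exact: pval_inj.
  move=> v /= /eqP; rewrite subr_eq0 => vP.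
  by exists (ProlongAlg (vP : v \in prolong_pred)).
rewrite tmapBl cotensl_id_comul cotensr_id_comul.
have /eqP -> : cotensl (val x) == cotensr (val x) by exact: (valP x).
by rewrite subrr.
Qed.

Definition prolong_coact (x : prolong_alg) : prolong_alg \ox H :=
  sval (cid (prolong_coact_subproof x)).

Lemma prolong_coactE x :
  tmap pval idfun (prolong_coact x) = id_comul (val x).
Proof. exact: (svalP (cid (prolong_coact_subproof x))). Qed.

Lemma prolong_coact_linear : linear prolong_coact.
Proof.
move=> k x y; apply: (tmap_inj pval_inj).
by rewrite [RHS]linearP /= !prolong_coactE !linearP.
Qed.

Lemma prolong_coact_monoid : monoid_morphism prolong_coact.
Proof.
have [p1 pM] := tmap_alg pval_alg (idfun_alg H).
have [c1 cM] := id_comul_alg.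
split; first by apply: (tmap_inj pval_inj); rewrite prolong_coactE rmorph1 c1 p1.
move=> x y; apply: (tmap_inj pval_inj).
by rewrite prolong_coactE rmorphM cM pM !prolong_coactE.
Qed.

HB.instance Definition _ := GRing.isLinear.Build K prolong_alg (prolong_alg \ox H)
  *:%R prolong_coact prolong_coact_linear.
HB.instance Definition _ :=
  GRing.isMonoidMorphism.Build prolong_alg (prolong_alg \ox H)
    prolong_coact prolong_coact_monoid.

Lemma prolong_coactA x :
  tassoc (tmap prolong_coact idfun (prolong_coact x)) =
  tmap idfun (comul H) (prolong_coact x).
Proof.
apply: (tmap_inj pval_inj); set y := prolong_coact x.
transitivity (tassoc (tmap id_comul idfun (tmap pval (idfun : H -> H) y))).
  elim/tensor_ind: y => [|y z IHy IHz|p h]; first by rewrite !linear0.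
    by rewrite !linearD /= IHy IHz.
  by rewrite !tmapE /= tmap_tassoc prolong_coactE.
rewrite prolong_coactE id_comulA -(prolong_coactE x) !tmap_comp.
exact: eq_tmap.
Qed.

Lemma prolong_coact_counit x :
  trunit (tmap idfun (counit H) (prolong_coact x)) = x.
Proof.
by apply: pval_inj; rewrite linear_trunit prolong_coactE id_comul_counit.
Qed.

Definition prolong : comodAlg H :=
  @ComodAlg K H prolong_alg prolong_coact prolong_coactA prolong_coact_counit.

Lemma coinv_prolong_subproof (b : coinv A) : (val b *t 1 : A \ox H) \in prolong_pred.
Proof.
rewrite unfold_in /prolong_pred /cotensl /cotensr /= !tmapE /= coinvP tassocE /=.
by rewrite rmorph1 -tpure1 tmapE rmorph1.
Qed.

Definition coinv_prolong (b : coinv A) : prolong :=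
  ProlongAlg (coinv_prolong_subproof b).

Lemma coinv_prolong_linear : linear coinv_prolong.
Proof.
move=> k x y; apply: val_inj.
by rewrite [RHS]linearP /= tpureDl tpureZl.
Qed.

Lemma coinv_prolong_monoid : monoid_morphism coinv_prolong.
Proof.
split=> [|x y]; apply: val_inj; first by rewrite [RHS]rmorph1.
by rewrite [RHS]rmorphM /= tpureM mulr1.
Qed.

HB.instance Definition _ := GRing.isLinear.Build K (coinv A) prolong
  *:%R coinv_prolong coinv_prolong_linear.
HB.instance Definition _ := GRing.isMonoidMorphism.Build (coinv A) prolong
  coinv_prolong coinv_prolong_monoid.

End Prolongation.

Section Cleft.
Variables (K : fieldType) (H : hopfAlg K).

Definition colinear (V W : lmodType K) (rV : {linear V -> V \ox H})
    (rW : {linear W -> W \ox H}) (f : {linear V -> W}) : Prop :=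
  forall v, rW (f v) = tmap f idfun (rV v).

Definition convolution (A : algType K) (f g : {linear H -> A}) (h : H) : A :=
  tmul (tmap f g (comul H h)).

Definition conv_invertible (A : algType K) (f : {linear H -> A}) : Prop :=
  exists g : {linear H -> A}, forall h,
    convolution f g h = (counit H h)%:A /\ convolution g f h = (counit H h)%:A.

Definition strong_connection (A : comodAlg H) (l : {linear H -> A \ox A}) : Prop :=
  [/\ l 1 = 1 *t 1,
      forall h, tmul (l h) = (counit H h)%:A,
      forall h, tassoc (tmap l idfun (comul H h)) = tmap idfun (coact A) (l h)
    & forall h, tmap (antipode H) l (comul H h) =
        tassoc (tmap tflip idfun (tmap (coact A) idfun (l h)))].

Definition principal (A : comodAlg H) : Prop :=
  exists l : {linear H -> A \ox A}, strong_connection l.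

Definition cleft (A : comodAlg H) : Prop :=
  principal A /\
  exists j : {linear H -> A},
    [/\ colinear (comul H) (coact A) j, j 1 = 1 & conv_invertible j].

(* A is a cleft extension of B, where B is identified through iota with the
   subalgebra of coinvariants of A. *)
Definition cleft_extension (A : comodAlg H) (B : algType K)
    (iota : {lrmorphism B -> A}) : Prop :=
  [/\ injective iota,
      forall a : A, coact A a = a *t 1 <-> exists b, iota b = a
    & cleft A].

End Cleft.

(* The right H'-coaction (id (x) pi) o Delta_H on H. *)
Definition push_coact (K : fieldType) (H H' : hopfAlg K) (pi : hopfHom H H') :
  H -> H \ox H' := tmap idfun pi \o comul H.
HB.instance Definition _ (K : fieldType) (H H' : hopfAlg K) (pi : hopfHom H H') :=
  GRing.Linear.on (push_coact pi).

(* Main.v *)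
Require Import Defs.
From HB Require Import structures.
From mathcomp Require Import all_boot all_order all_algebra reals complex.

(** For a coalgebra H and an algebra A the linear maps H -> A form an algebra
    under convolution, with unit h |-> eps(h) 1, and postcomposition with an
    algebra map A -> B is an algebra map Hom(H, A) -> Hom(H, B).  Everything
    rests on three consequences: convolution inverses are unique, a product of
    invertible maps is invertible, and algebra maps preserve invertibility.

    Suppose f : H -> A is Hbar-colinear, unital and has convolution inverse g.
    The map j(h) = f(h_1) (x) h_2 into A (x) H is the convolution product of
    h |-> f(h) (x) 1 and h |-> 1 (x) h.  The second factor is invertible, with
    inverse h |-> 1 (x) S(h), so j is invertible, with inverse
    h |-> g(h_2) (x) S(h_1) (conv_inverse_tens).  The prolongation is the
    equalizer of two algebra maps on A (x) H, and j lies in it because f is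
    colinear; by uniqueness of inverses the inverse of j lies in it as well
    (conv_inverse_equalizer), with no computation of coproducts of antipodes.
    So j is a cleaving map for the prolongation (prolong_cleaving).

    A cleaving map j with inverse g always yields the strong connection
    l(h) = g(h_1) (x) j(h_2) (cleaving_principal).  Its left colinearity amounts
    to rho(g(h)) = g(h_2) (x) S(h_1), which is once more uniqueness of inverses:
    rho o j is the product of h |-> j(h) (x) 1 and h |-> 1 (x) h
    (coact_conv_inverse).

    Conversely, id (x) eps is an algebra map A (x) H -> A, and composing it with
    a cleaving map of the prolongation gives f.  It is Hbar-colinear because
    applying counits to the defining equation of the cotensor product turns
    a_0 (x) a_1 eps(h) into a (x) pi(h) (coact_id_counit).  The same map
    id (x) eps recovers b from b (x) 1 and shows that all coinvariants of the
    prolongation have this form (coinv_prolong_inj, coinv_prolongP). *)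

Set Implicit Arguments.
Unset Strict Implicit.
Unset Printing Implicit Defensive.

Import GRing.Theory.
Local Open Scope ring_scope.

(** * Naturality of the structure maps of tensor products *)

Section TensorMaps.
Variable K : fieldType.

Lemma tassoc_natural (U U' V V' W W' : lmodType K) (f : {linear U -> U'})
    (g : {linear V -> V'}) (k : {linear W -> W'}) (x : (U \ox V) \ox W) :
  tmap f (tmap g k) (tassoc x) = tassoc (tmap (tmap f g) k x).
Proof.
apply: (@tensor_ext3 _ _ _ _ _ (tmap f (tmap g k) \o tassoc)
  (tassoc \o tmap (tmap f g) k)) => u v w /=.
by rewrite tassocE !tmapE /= !tmapE tassocE.
Qed.

Lemma tflip_natural (V V' W W' : lmodType K) (f : {linear V -> V'})
    (g : {linear W -> W'}) (x : V \ox W) :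
  tflip (tmap f g x) = tmap g f (tflip x).
Proof.
apply: (@tensor_ext _ _ _ _ (tflip \o tmap f g) (tmap g f \o tflip)) => v w /=.
by rewrite tmapE !tflipE tmapE.
Qed.

Lemma tflipK (V W : lmodType K) (x : V \ox W) : tflip (tflip x) = x.
Proof.
apply: (@tensor_ext _ _ _ _ (tflip \o tflip) idfun) => v w /=.
by rewrite !tflipE.
Qed.

Lemma tmulA (A : algType K) (x : (A \ox A) \ox A) :
  tmul (tmap tmul idfun x) = tmul (tmap idfun tmul (tassoc x)).
Proof.
apply: (@tensor_ext3 _ _ _ _ _ (tmul \o tmap tmul idfun)
  (tmul \o tmap idfun tmul \o tassoc)) => u v w /=.
by rewrite tassocE !tmapE /= !tmulE mulrA.
Qed.

Definition tinl (A B : algType K) (a : A) : A \ox B := a *t 1.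
Definition tinr (A B : algType K) (b : B) : A \ox B := 1 *t b.

Lemma tinl_linear (A B : algType K) : linear (@tinl A B).
Proof. by move=> k a a'; rewrite /tinl tpureDl tpureZl. Qed.
Lemma tinr_linear (A B : algType K) : linear (@tinr A B).
Proof. by move=> k b b'; rewrite /tinr tpureDr tpureZr. Qed.

HB.instance Definition _ (A B : algType K) :=
  GRing.isLinear.Build K A (A \ox B) *:%R (@tinl A B) (@tinl_linear A B).
HB.instance Definition _ (A B : algType K) :=
  GRing.isLinear.Build K B (A \ox B) *:%R (@tinr A B) (@tinr_linear A B).

Lemma tinl_alg (A B : algType K) : monoid_morphism (@tinl A B).
Proof. by split=> // a a'; rewrite /tinl tpureM mulr1. Qed.
Lemma tinr_alg (A B : algType K) : monoid_morphism (@tinr A B).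
Proof. by split=> // b b'; rewrite /tinr tpureM mulr1. Qed.

End TensorMaps.

(** * The convolution algebra *)

Section ConvolutionAlgebra.
Variables (K : fieldType) (H : hopfAlg K).

Lemma convolution_linear (A : algType K) (f g : {linear H -> A}) :
  linear (convolution f g).
Proof. by move=> k x y; rewrite /convolution !linearP. Qed.

HB.instance Definition _ (A : algType K) (f g : {linear H -> A}) :=
  GRing.isLinear.Build K H A *:%R (convolution f g) (convolution_linear f g).

Definition conv_unit (A : algType K) (h : H) : A := (counit H h : K)%:A.

Lemma conv_unit_linear (A : algType K) : linear (@conv_unit A).
Proof.
by move=> k x y; rewrite /conv_unit linearP [in LHS]scalerDl -scalerA.
Qed.

HB.instance Definition _ (A : algType K) :=
  GRing.isLinear.Build K H A *:%R (@conv_unit A) (@conv_unit_linear A).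

Lemma eq_convolution (A : algType K) (f f' g g' : {linear H -> A}) :
  f =1 f' -> g =1 g' -> convolution f g =1 convolution f' g'.
Proof. by move=> ff' gg' h; rewrite /convolution (eq_tmap ff' gg'). Qed.

Lemma convolutionA (A : algType K) (f g k : {linear H -> A}) :
  convolution (convolution f g) k =1 convolution f (convolution g k).
Proof.
move=> h; transitivity
  (tmul (tmap tmul idfun
    (tmap (tmap f g) k (tmap (comul H) idfun (comul H h))))).
  by rewrite !tmap_comp; congr tmul; apply: eq_tmap.
rewrite tmulA -tassoc_natural comulA !tmap_comp.
by congr tmul; apply: eq_tmap.
Qed.

Lemma convolution1l (A : algType K) (f : {linear H -> A}) :
  convolution (@conv_unit A) f =1 f.
Proof.
move=> h; rewrite -[in RHS](counitl h) /convolution.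
elim/tensor_ind: (comul H h) => [|x y IHx IHy|u v]; first by rewrite !linear0.
  by rewrite !linearD /= IHx IHy.
by rewrite !tmapE tmulE tlunitE linearZ -scalerAl mul1r.
Qed.

Lemma convolution1r (A : algType K) (f : {linear H -> A}) :
  convolution f (@conv_unit A) =1 f.
Proof.
move=> h; rewrite -[in RHS](counitr h) /convolution.
elim/tensor_ind: (comul H h) => [|x y IHx IHy|u v]; first by rewrite !linear0.
  by rewrite !linearD /= IHx IHy.
by rewrite !tmapE tmulE trunitE linearZ -scalerAr mulr1.
Qed.

Definition conv_inverse (A : algType K) (f g : {linear H -> A}) : Prop :=
  convolution f g =1 @conv_unit A /\ convolution g f =1 @conv_unit A.

Lemma conv_invertibleP (A : algType K) (f : {linear H -> A}) :
  conv_invertible f <-> exists g, conv_inverse f g.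
Proof.
split=> [[g fg]|[g [fg gf]]]; exists g; first by split=> h; have [] := fg h.
by move=> h; split; [apply: fg|apply: gf].
Qed.

(** The usual g = g (f g') = (g f) g' = g'.  The maps f and f' are identified
    only pointwise, since equal values on H do not make two bundled linear maps
    syntactically interchangeable. *)
Lemma conv_inverse_uniq (A : algType K) (f f' g g' : {linear H -> A}) :
  f =1 f' -> conv_inverse f g -> conv_inverse f' g' -> g =1 g'.
Proof.
move=> ff' [_ gf] [fg' _] h.
rewrite -[LHS]convolution1r -(eq_convolution (frefl g) fg').
rewrite -(eq_convolution (frefl g) (eq_convolution ff' (frefl g'))).
by rewrite -convolutionA (eq_convolution gf (frefl g')) convolution1l.
Qed.

Lemma conv_inverseM (A : algType K) (f f' g g' : {linear H -> A}) :
  conv_inverse f g -> conv_inverse f' g' ->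
  conv_inverse (convolution f f') (convolution g' g).
Proof.
have half (a a' b b' : {linear H -> A}) : convolution a b =1 @conv_unit A ->
    convolution a' b' =1 @conv_unit A ->
    convolution (convolution a a') (convolution b' b) =1 @conv_unit A.
  move=> ab ab' h; rewrite convolutionA -[RHS]ab.
  apply: eq_convolution => // {}h.
  by rewrite /= -convolutionA (eq_convolution ab' (frefl b)) convolution1l.
by move=> [fg gf] [fg' gf']; split; apply: half.
Qed.

Lemma convolution_morph (A B : algType K) (phi : {linear A -> B})
    (f g : {linear H -> A}) : monoid_morphism phi ->
  phi \o convolution f g =1 convolution (phi \o f) (phi \o g).
Proof.
move=> [_ phiM] h; rewrite /convolution /=.
elim/tensor_ind: (comul H h) => [|x y IHx IHy|u v]; first by rewrite !linear0.
  by rewrite !linearD /= IHx IHy.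
by rewrite !tmapE !tmulE phiM.
Qed.

Lemma conv_unit_morph (A B : algType K) (phi : {linear A -> B}) :
  monoid_morphism phi -> phi \o @conv_unit A =1 @conv_unit B.
Proof. by move=> [phi1 _] h; rewrite /conv_unit /= linearZ phi1. Qed.

Lemma conv_inverse_morph (A B : algType K) (phi : {linear A -> B})
    (f g : {linear H -> A}) : monoid_morphism phi ->
  conv_inverse f g -> conv_inverse (phi \o f) (phi \o g).
Proof.
move=> phiM [fg gf]; split=> h.
  by rewrite -(convolution_morph f g phiM) /= fg -(conv_unit_morph phiM).
by rewrite -(convolution_morph g f phiM) /= gf -(conv_unit_morph phiM).
Qed.

(** phi o v and psi o v are convolution inverses of the same map.  Used to see
    that an invertible map with values in the equalizer of two algebra maps has
    its inverse in that equalizer, too. *)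
Lemma conv_inverse_equalizer (B C : algType K) (phi psi : {linear B -> C})
    (u v : {linear H -> B}) : monoid_morphism phi -> monoid_morphism psi ->
  conv_inverse u v -> phi \o u =1 psi \o u -> phi \o v =1 psi \o v.
Proof.
move=> phiM psiM uv eq_u.
have phi_uv := conv_inverse_morph phiM uv.
exact: conv_inverse_uniq eq_u phi_uv (conv_inverse_morph psiM uv).
Qed.

(** Invertibility descends along an inclusion of algebras once the inverse is
    known to take values in the subalgebra. *)
Lemma conv_inverse_inj (A B : algType K) (phi : {linear A -> B})
    (f g : {linear H -> A}) : monoid_morphism phi -> injective phi ->
  conv_inverse (phi \o f) (phi \o g) -> conv_inverse f g.
Proof.
move=> phiM phi_inj [fg gf]; split=> h; apply: phi_inj.
  by rewrite [LHS](convolution_morph f g phiM) fg -(conv_unit_morph phiM).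
by rewrite [LHS](convolution_morph g f phiM) gf -(conv_unit_morph phiM).
Qed.

(** The antipode axioms enter only here. *)
Lemma conv_inverse_antipode : conv_inverse (idfun : H -> H) (antipode H).
Proof. by split=> h; [apply: antipoder|apply: antipodel]. Qed.

Lemma comul1 : comul H 1 = 1 *t 1.
Proof. by rewrite rmorph1. Qed.

Lemma conv_inverse1 (A : algType K) (f g : {linear H -> A}) :
  conv_inverse f g -> f 1 = 1 -> g 1 = 1.
Proof.
move=> [_ /(_ 1)]; rewrite /convolution comul1 tmapE tmulE /conv_unit rmorph1.
by move=> gf f1; rewrite f1 mulr1 scale1r in gf.
Qed.

Lemma convolution_tinl_tinr (A B : algType K) (f : {linear H -> A})
    (g : {linear H -> B}) h :
  convolution (@tinl K A B \o f) (@tinr K A B \o g) h = tmap f g (comul H h).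
Proof.
rewrite /convolution.
elim/tensor_ind: (comul H h) => [|x y IHx IHy|u v]; first by rewrite !linear0.
  by rewrite !linearD /= IHx IHy.
by rewrite !tmapE tmulE /= /tinl /tinr tpureM mulr1 mul1r.
Qed.

Lemma convolution_tinr_tinl (A B : algType K) (f : {linear H -> A})
    (g : {linear H -> B}) h :
  convolution (@tinr K A B \o g) (@tinl K A B \o f) h =
  tmap f g (tflip (comul H h)).
Proof.
rewrite /convolution.
elim/tensor_ind: (comul H h) => [|x y IHx IHy|u v]; first by rewrite !linear0.
  by rewrite !linearD /= IHx IHy.
by rewrite tflipE !tmapE tmulE /= /tinl /tinr tpureM mulr1 mul1r.
Qed.

(** The product of h |-> f(h) (x) 1 and h |-> 1 (x) h is
    h |-> f(h_1) (x) h_2, and the product of the inverses in the reverse order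
    is h |-> g(h_2) (x) S(h_1). *)
Lemma conv_inverse_tens (A : algType K) (f g : {linear H -> A}) :
  conv_inverse f g ->
  conv_inverse (convolution (@tinl K A H \o f) (@tinr K A H \o idfun))
    (convolution (@tinr K A H \o antipode H) (@tinl K A H \o g)).
Proof.
move=> fg; apply: conv_inverseM.
  by apply: conv_inverse_morph fg; apply: tinl_alg.
by apply: conv_inverse_morph conv_inverse_antipode; apply: tinr_alg.
Qed.

End ConvolutionAlgebra.

(** * Cleaving maps give strong connections *)

Section Cleaving.
Variables (K : fieldType) (H : hopfAlg K) (A : comodAlg H).
Variables j g : {linear H -> A}.
Hypothesis jcol : colinear (comul H) (coact A) j.
Hypothesis jg : conv_inverse j g.

(** rho o g is the inverse of rho o j, which by colinearity is
    h |-> j(h_1) (x) h_2, whose inverse is known from conv_inverse_tens. *)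
Lemma coact_conv_inverse h :
  coact A (g h) = tmap g (antipode H) (tflip (comul H h)).
Proof.
rewrite -convolution_tinr_tinl.
have rg := conv_inverse_morph (lrmorphism_alg (coact A)) jg.
apply: (conv_inverse_uniq _ rg (conv_inverse_tens jg)) => {}h.
by rewrite /= convolution_tinl_tinr jcol.
Qed.

(** The strong connection is l(h) = g(h_1) (x) j(h_2).  Its right colinearity is
    that of j, its left colinearity is coact_conv_inverse. *)
Lemma cleaving_principal : j 1 = 1 -> principal A.
Proof.
move=> j1; exists (tmap g j \o comul H); split=> [|h|h|h] /=.
- by rewrite comul1 tmapE j1 (conv_inverse1 jg j1).
- by case: jg => _ /(_ h).
- transitivity (tassoc (tmap (tmap g j) idfun
                    (tmap (comul H) idfun (comul H h)))).
    by rewrite tmap_comp; congr tassoc; apply: eq_tmap.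
  rewrite -tassoc_natural comulA !tmap_comp; apply: eq_tmap => // k /=.
  by rewrite jcol.
- transitivity (tmap (antipode H) (tmap g j)
                  (tmap idfun (comul H) (comul H h))).
    by rewrite tmap_comp; apply: eq_tmap.
  rewrite -comulA tassoc_natural !tmap_comp; congr tassoc.
  apply: eq_tmap => // k /=.
  by rewrite coact_conv_inverse tflip_natural tflipK.
Qed.

End Cleaving.

(** * Cleaving maps of the prolongation *)

Section ProlongationCleft.
Variables (K : fieldType) (H Hbar : hopfAlg K) (pi : hopfHom H Hbar).
Variable A : comodAlg Hbar.

Local Notation val_pi := (@pval K H Hbar pi A).
Local Notation cotl := (@cotensl K H Hbar A).
Local Notation cotr := (@cotensr K H Hbar pi A).

Definition id_counit : A \ox H -> A := trunit \o tmap idfun (counit H).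
HB.instance Definition _ := GRing.Linear.on id_counit.

Lemma id_counitE a h : id_counit (a *t h) = (counit H h : K) *: a.
Proof. by rewrite /id_counit /= tmapE trunitE. Qed.

Lemma id_counit_alg : monoid_morphism id_counit.
Proof.
split; first by rewrite -tpure1 id_counitE rmorph1 scale1r.
apply: tensor_morphM => a h a' h'; rewrite tpureM /= !id_counitE rmorphM.
by rewrite -scalerAl -scalerAr scalerA.
Qed.

(** a eps(h_1) (x) h_2 = a (x) h. *)
Lemma id_counit_id_comul (x : A \ox H) :
  tmap id_counit idfun (id_comul x) = x.
Proof.
elim/tensor_ind: x => [|x y IHx IHy|a h]; first by rewrite !linear0.
  by rewrite !linearD /= IHx IHy.
rewrite id_comulE -[in RHS](counitl h).
elim/tensor_ind: (comul H h) => [|x y IHx IHy|u v].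
- by rewrite !(tpure0r, linear0).
- by rewrite !(tpureDr, linearD) /= IHx IHy.
- by rewrite tassocVE !tmapE /= id_counitE tlunitE tpureZl tpureZr.
Qed.

(** Cancelling the last factor of a (x) pi(h_1) (x) h_2 against the counit leaves
    a (x) pi(h). *)
Lemma counit_cotensr (x : A \ox H) :
  trunit (tmap idfun (counit H) (tassocV (cotensr pi x))) = tmap idfun pi x.
Proof.
elim/tensor_ind: x => [|x y IHx IHy|a h]; first by rewrite !linear0.
  by rewrite !linearD /= IHx IHy.
rewrite /cotensr tmapE trunit_tassocV tmapE /=; congr (_ *t _).
by rewrite -[RHS]/((pi : {linear _ -> _}) h) -[in RHS](counitr h) linear_trunit.
Qed.

Lemma prolongP (x : prolong pi A) : cotensl (pval x) = cotensr pi (pval x).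
Proof. exact/eqP/(valP x). Qed.

(** Counit in the last factor of the equation
    a_0 (x) a_1 (x) h = a (x) pi(h_1) (x) h_2 that defines the prolongation. *)
Lemma coact_id_counit (x : prolong pi A) :
  coact A (id_counit (pval x)) = tmap idfun pi (pval x).
Proof.
rewrite /id_counit /= linear_trunit -counit_cotensr -prolongP.
by rewrite /cotensl /= tassocK.
Qed.

Lemma coact_prolongE (x : prolong pi A) :
  tmap val_pi idfun (coact (prolong pi A) x) = id_comul (pval x).
Proof. exact: prolong_coactE. Qed.

Lemma coinv_prolong_inj : injective (coinv_prolong pi (A := A)).
Proof.
move=> b c /(congr1 (id_counit \o val_pi)).
rewrite /= [pval _]/(val b *t 1) [pval (coinv_prolong pi c)]/(val c *t 1).
by rewrite !id_counitE rmorph1 !scale1r => /val_inj.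
Qed.

(** Applying id (x) eps (x) id to (id (x) Delta) x = x (x) 1 gives x = b (x) 1,
    where b = (id (x) eps) x, and then coact_id_counit says that b is
    coinvariant. *)
Lemma coinv_prolongP (x : prolong pi A) :
  coact (prolong pi A) x = x *t 1 <-> exists b, coinv_prolong pi b = x.
Proof.
split=> [xcoinv|[b <-]]; last first.
  apply: (tmap_inj (@pval_inj _ _ _ pi A)); rewrite coact_prolongE tmapE.
  by rewrite [pval _]/(val b *t 1) id_comulE comul1 tassocVE.
have xE : pval x = id_counit (pval x) *t 1.
  by rewrite -[LHS]id_counit_id_comul -coact_prolongE xcoinv !tmapE.
have bcoinv : id_counit (pval x) \in coinv_pred (A := A).
  rewrite unfold_in /coinv_pred coact_id_counit [in tmap _ _ _]xE tmapE.
  by rewrite rmorph1.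
by exists (Coinv bcoinv); apply: pval_inj; rewrite [RHS]xE.
Qed.

(** The universal property of the prolongation as an equalizer. *)
Lemma prolong_lift (V : lmodType K) (u : {linear V -> A \ox H}) :
  cotl \o u =1 cotr \o u ->
  exists v : {linear V -> prolong pi A}, val_pi \o v =1 u.
Proof.
move=> uP.
have mem x : u x \in prolong_pred pi (A := A) by apply/eqP; apply: uP.
pose v x : prolong pi A := ProlongAlg (mem x).
have vlin : linear v.
  by move=> k x y; apply: pval_inj; rewrite [RHS]linearP; apply: (linearP u).
pose vL := GRing.isLinear.Build K V (prolong pi A) *:%R v vlin.
pose v' : {linear V -> prolong pi A} := HB.pack v vL.
by exists v'.
Qed.

(** For j(h) = a (x) k both sides are a (x) pi(k): on the left by
    coact_id_counit, on the right because H-colinearity of j makes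
    j(h_1) (x) h_2 equal to a (x) k_1 (x) k_2. *)
Lemma colinear_id_counit (j : {linear H -> prolong pi A}) :
  colinear (comul H) (coact (prolong pi A)) j ->
  colinear (push_coact pi) (coact A) (id_counit \o (val_pi \o j)).
Proof.
move=> jcol h; rewrite /= coact_id_counit.
rewrite -[pval (j h) in LHS]id_counit_id_comul -coact_prolongE jcol.
by rewrite /push_coact /= !tmap_comp; apply: eq_tmap.
Qed.

(** Both maps send f(h_1) (x) h_2 to f(h_1) (x) pi(h_2) (x) h_3, on the left by
    colinearity of f. *)
Lemma cotensl_cleaving (f : {linear H -> A}) :
  colinear (push_coact pi) (coact A) f ->
  cotl \o (tmap f idfun \o comul H) =1 cotr \o (tmap f idfun \o comul H).
Proof.
move=> fcol h; rewrite /cotensl /cotensr /= !tmap_comp.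
transitivity (tmap f (tmap pi idfun) (tmap idfun (comul H) (comul H h))).
  rewrite -comulA tassoc_natural tmap_comp; congr tassoc.
  apply: eq_tmap => // k /=; rewrite fcol /push_coact /= tmap_comp.
  exact: eq_tmap.
by rewrite tmap_comp; apply: eq_tmap.
Qed.

(** The cleaving map is j(h) = f(h_1) (x) h_2. *)
Lemma prolong_cleaving (f : {linear H -> A}) :
  colinear (push_coact pi) (coact A) f -> f 1 = 1 -> conv_invertible f ->
  exists j : {linear H -> prolong pi A},
    [/\ colinear (comul H) (coact (prolong pi A)) j, j 1 = 1
      & conv_invertible j].
Proof.
move=> fcol f1 /conv_invertibleP[g fg].
(* u is j and v is its inverse, both still as maps into A (x) H. *)
have uP h := convolution_tinl_tinr f (idfun : H -> H) h.
have uv := conv_inverse_tens fg.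
set u := convolution _ _ in uP uv; set v := convolution _ _ in uv.
have eq_u : cotl \o u =1 cotr \o u.
  by move=> h; rewrite /= uP; apply: cotensl_cleaving.
have [j jP] := prolong_lift eq_u.
have [k kP] := prolong_lift
  (conv_inverse_equalizer (@cotensl_alg K H Hbar A)
    (@cotensr_alg K H Hbar pi A) uv eq_u).
have jE h : pval (j h) = tmap f idfun (comul H h) by rewrite -uP; apply: jP.
exists j; split.
- move=> h; apply: (tmap_inj (@pval_inj _ _ _ pi A)); rewrite coact_prolongE jE.
  rewrite /id_comul /= !tmap_comp.
  apply: (can_inj (@tassocK _ _ _ _)); rewrite tassocVK.
  (* Both sides are f(h_1) (x) h_2 (x) h_3. *)
  transitivity (tassoc (tmap (tmap f idfun) idfun
                  (tmap (comul H) idfun (comul H h)))).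
    rewrite -tassoc_natural comulA tmap_comp; apply: eq_tmap => // l /=.
    by rewrite tmap_id.
  by rewrite tmap_comp; congr tassoc; apply: eq_tmap => // l /=; rewrite jE.
- by apply: pval_inj; rewrite jE comul1 tmapE f1.
- apply/conv_invertibleP; exists k.
  apply: (conv_inverse_inj (pval_alg pi A) (@pval_inj _ _ _ pi A)).
  case: uv => uv vu; split=> h.
    by rewrite -uv; apply: eq_convolution.
  by rewrite -vu; apply: eq_convolution.
Qed.

End ProlongationCleft.

Theorem proposition4p1 (R : realType) (H Hbar : hopfAlg R[i])
    (pi : hopfHom H Hbar) (A : comodAlg Hbar) :
  cleft_extension (coinv_prolong pi (A := A)) <->
  exists f : {linear H -> A},
    [/\ colinear (push_coact pi) (coact A) f, f 1 = 1 & conv_invertible f].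
Proof.
split=> [[_ _ [_ [j [jcol j1 /conv_invertibleP[g jg]]]]]|[f [fcol f1 finv]]].
  exists (@id_counit _ H _ A \o (@pval _ _ _ pi A \o j)); split.
  - exact: colinear_id_counit.
  - by rewrite /= j1 (pval_alg pi A).1 (id_counit_alg H A).1.
  - apply/conv_invertibleP.
    exists (@id_counit _ H _ A \o (@pval _ _ _ pi A \o g)).
    apply: conv_inverse_morph; first exact: id_counit_alg.
    by apply: conv_inverse_morph jg; apply: pval_alg.
split; [exact: coinv_prolong_inj|exact: coinv_prolongP|].
have [j [jcol j1 jinv]] := prolong_cleaving fcol f1 finv.
split; last by exists j.
by have [g jg] := (conv_invertibleP j).1 jinv; apply: cleaving_principal jg j1.
Qed.
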